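(* Let $Q$ be a finite quiver with vertex set $I$ and let $d,n\in\mathbf{N}I$. For $S_*\in\Phi_{d,n}$, $j\in I$ and $1\le m\le d_j$, let $\lambda^j_m$ be the number of $j$-vertices $(q,i,w)\in C(S_* )$ such that there are at least $m$ $j$-vertices $(q',i',w')\in S_*$ with $(q,i,w)<(q',i',w')$. Then the map $\varphi:\Phi_{d,n}\to S_{d,n}$, $S_*\mapsto(\lambda^j_m)_{j\in I,\,1\le m\le d_j}$, is a (well-defined) bijection.
   Context: Multipartitions: the Euler form is $\langle d,e\rangle=\sum_{i\in I}d_ie_i-\sum_{\alpha:i\to j}d_ie_j$; a vertex $i$ is viewed as a unit vector, so $\langle e,i\rangle=e_i-\sum_{\alpha:j\to i}e_j$. The order on $\mathbf{N}I$ is componentwise, $e<d$ meaning $e\le d$ and $e\ne d$. $S_{d,n}$ is the set of tuples $\lambda=(\lambda^i_1\ge\dots\ge\lambda^i_{d_i}\ge0)_{i\in I}$ of partitions with non-negative integer entries such that for every dimension vector $0\le e<d$ there exists $i\in I$ with $\lambda^i_{d_i-e_i}<n_i-\langle e,i\rangle$, with the convention $\lambda^i_0=+\infty$. Forests: a path $w=\alpha_1\cdots\alpha_m$ in $Q$ is a word of composable arrows, $\alpha_1$ traversed first; there is an empty path $()$ at each vertex; $t(w)$ is the terminal vertex of $w$ ($t(())=q$ for the empty path at $q$). $T_q$ is the tree of all paths starting in $q$, with edges $\alpha_1\cdots\alpha_m\to\alpha_1\cdots\alpha_m\alpha_{m+1}$. $\mathcal{F}_n(Q)$ consists of $n_q$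 copies $T_{q,1},\dots,T_{q,n_q}$ of $T_q$ for each $q\in I$; its vertices are triples $(q,i,w)$; $(q,i,w)$ is a $j$-vertex if $t(w)=j$. A subforest $S_*=(S_{q,i})$ consists of subsets $S_{q,i}\subset T_{q,i}$ (possibly empty) closed under predecessors (initial subwords). Order on vertices: fix a total order on $I$ and a total order on each set of parallel arrows. For arrows $\alpha:i\to j$, $\beta:k\to\ell$ set $\alpha<\beta$ if $i<k$, or $i=k$ and $j<\ell$, or $i=k$, $j=\ell$ and $\alpha<\beta$ in the chosen order. Paths from the same vertex are ordered lexicographically: $w<w'$ if at the first position where they differ the arrow of $w$ is smaller, or if $w$ is a proper initial subword of $w'$. Triples: $(q,i,w)<(q',i',w')$ if $q<q'$, or $q=q'$ and $i<i'$, or $q=q'$, $i=i'$ and $w<w'$. Corona: $C(S_* )$ is the set of $(q,i,w)\in\mathcal{F}_n(Q)$, $w=\alpha_1\cdots\alpha_\ell$, with $w\notin S_{q,i}$ but $\alpha_1\cdots\alpha_{\ell-1}\in S_{q,i}$; also $(q,i,())\in C(S_* )$ whenever $S_{q,i}=\emptyset$. $\Phi_{d,n}$: fix complex vector spaces $M_q$ of dimension $d_q$ and $V_q$ of dimension $n_q$ with basis $(v_{q,i})_{1\le i\le n_q}$. $\mathrm{H}_{d,n}(Q)$ is the geometric quotient by $\prod_q\mathrm{GL}(M_q)$ of the set of pairs $(M_*,f_* )$, $M_*=(M_\alpha:M_i\to M_j)_{\alpha:i\to j}$, $f_*=(f_q:V_q\to M_q)_q$, such that the image of $f_*$ generates the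 representation $M_*$. With $M_w=M_{\alpha_m}\circ\cdots\circ M_{\alpha_1}$, $U_{S_*}\subset\mathrm{H}_{d,n}(Q)$ is the set of classes of $(M_*,f_* )$ such that for every $j\in I$ the elements $M_wf_q(v_{q,i})$, $(q,i,w)\in S_*$, $t(w)=j$, form a basis of $M_j$. $\Phi_{d,n}$ is the set of all subforests $S_*$ of $\mathcal{F}_n(Q)$ with $U_{S_*}\ne\emptyset$. *)

(* Defs.v *)
From HB Require Import structures.
From mathcomp Require Import all_boot all_order all_algebra finmap.
From mathcomp Require Import boolp classical_sets functions cardinality reals.
From mathcomp Require Import complex.

Set Implicit Arguments.
Unset Strict Implicit.
Unset Printing Implicit Defensive.

Import Order.TTheory GRing.Theory Num.Theory.

Local Open Scope classical_set_scope.
Local Open Scope card_scope.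
Local Open Scope ring_scope.

Record quiver := Quiver {
  vertex : finType;
  arrow : finType;
  src : arrow -> vertex;
  tgt : arrow -> vertex }.

Arguments src {q} _.
Arguments tgt {q} _.

Definition total_order_in (T : Type) (D : pred T) (r : rel T) : Prop :=
  [/\ {in D, reflexive r}, {in D &, antisymmetric r},
      {in D & &, transitive r} & {in D &, total r}].

Section Multipartitions.
Variable Q : quiver.

Definition dimvec := {ffun vertex Q -> nat}.

Definition unit_dimvec (i : vertex Q) : dimvec := [ffun j => (j == i : nat)].

Definition euler (d e : dimvec) : int :=
  \sum_(i : vertex Q) (d i)%:Z * (e i)%:Z
  - \sum_(a : arrow Q) (d (src a))%:Z * (e (tgt a))%:Z.

(* [part_lt l k z] is l_k < z, with parts indexed from 1 and l_0 = +oo. *)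
Definition part_lt (l : seq nat) (k : nat) (z : int) : bool :=
  (0 < k)%N && ((nth 0%N l k.-1)%:Z < z).

Definition multipartitions (d n : dimvec) :
    set (forall i : vertex Q, (d i).-tuple nat) :=
  [set l | (forall i, sorted geq (l i)) /\
    forall e : dimvec, (forall i, (e i <= d i)%N) -> e <> d ->
      exists i, part_lt (l i) (d i - e i) ((n i)%:Z - euler e (unit_dimvec i))].

End Multipartitions.

Arguments multipartitions {Q} d n _.

Section Forests.
Variables (Q : quiver) (n : dimvec Q).

(* A path is the word of its arrows, the arrow traversed first coming first;
   its starting vertex is kept separately. *)
Fixpoint path_from (q : vertex Q) (w : seq (arrow Q)) : bool :=
  if w is a :: w' then (src a == q) && path_from (tgt a) w' else true.

Definition path_end (q : vertex Q) (w : seq (arrow Q)) : vertex Q :=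
  last q (map tgt w).

(* Triples (q, i, w) in which w is an arbitrary word; the forest F_n(Q)
   consists of those for which w is a path starting in q. *)
Notation fvertex := {q : vertex Q & ('I_(n q) * seq (arrow Q))%type}.

Definition fvert (q : vertex Q) (i : 'I_(n q)) (w : seq (arrow Q)) : fvertex :=
  Tagged (fun q => 'I_(n q) * seq (arrow Q))%type (i, w).

Definition forest : set fvertex := [set x : fvertex | path_from (tag x) (tagged x).2].

Definition subforest (S : set fvertex) : Prop :=
  S `<=` forest /\
  forall q (i : 'I_(n q)) u w, S (fvert i (u ++ w)) -> S (fvert i u).

Definition is_jvertex (j : vertex Q) (x : fvertex) : bool :=
  path_end (tag x) (tagged x).2 == j.

Definition jvertices (j : vertex Q) (S : set fvertex) : set fvertex :=
  [set x : fvertex | S x /\ is_jvertex j x].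

Definition corona (S : set fvertex) : set fvertex :=
  [set x : fvertex | forest x /\ exists q (i : 'I_(n q)),
     (exists u a, [/\ x = fvert i (rcons u a), ~ S x & S (fvert i u)]) \/
     (x = fvert i [::] /\ forall u, ~ S (fvert i u))].

Section Order.
(* [leI] orders the vertices of the quiver and [leA] each set of parallel
   arrows; the values of [leA] on other pairs of arrows are never used. *)
Variables (leI : rel (vertex Q)) (leA : rel (arrow Q)).

Definition vertex_lt (i j : vertex Q) : bool := (i != j) && leI i j.

Definition arrow_lt (a b : arrow Q) : bool :=
  vertex_lt (src a) (src b) || (src a == src b) &&
    (vertex_lt (tgt a) (tgt b) || (tgt a == tgt b) && ((a != b) && leA a b)).

Fixpoint word_lt (w w' : seq (arrow Q)) : bool :=
  match w, w' with
  | _, [::] => false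
  | [::], _ :: _ => true
  | a :: u, b :: v => arrow_lt a b || (a == b) && word_lt u v
  end.

Definition fvertex_lt (x y : fvertex) : bool :=
  let: (i, w) := tagged x in let: (i', w') := tagged y in
  vertex_lt (tag x) (tag y) || (tag x == tag y) &&
    ((i < i')%N || (i == i' :> nat) && word_lt w w').

(* [`I_m #<= A] says that A has at least m elements. *)
Definition counted (S : set fvertex) (j : vertex Q) (m : nat) : set fvertex :=
  [set x : fvertex | jvertices j (corona S) x /\
           `I_m #<= [set y | jvertices j S y /\ fvertex_lt x y]].

(* The entry of index m (from 0) of the j-th tuple is the part of index m + 1.
   [fset_set] sends infinite sets to the empty one. *)
Definition multipartition_of (d : dimvec Q) (S : set fvertex)
    (j : vertex Q) : (d j).-tuple nat :=
  [tuple #|` fset_set (counted S j m.+1)| | m < d j].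

End Order.

Section Moduli.
(* [v q] is the chosen basis of V q. *)
Variables (K : fieldType) (M V : vertex Q -> vectType K)
  (v : forall q, (n q).-tuple (V q)).

Definition framed_rep : Type :=
  ((forall a : arrow Q, 'Hom(M (src a), M (tgt a))) *
   (forall q : vertex Q, 'Hom(V q, M q)))%type.

Definition generated (p : framed_rep) : Prop :=
  forall U : forall q, {vspace M q},
    (forall q, (limg (p.2 q) <= U q)%VS) ->
    (forall a, (p.1 a @: U (src a) <= U (tgt a))%VS) ->
    forall q, U q = fullv.

(* The orbit of p under the product of the groups GL(M q). *)
Definition orbit_of (p : framed_rep) : set framed_rep :=
  [set p' | exists g : forall q, 'End(M q),
    [/\ forall q, lker (g q) == 0%VS,
        forall a, p'.1 a = (g (tgt a) \o p.1 a \o (g (src a))^-1)%VF &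
        forall q, p'.2 q = (g q \o p.2 q)%VF]].

Definition hilbert_scheme : set (set framed_rep) :=
  [set orbit_of p | p in generated].

(* Vectors are carried together with the vertex q whose space M q they lie in,
   so that M_w can be applied along a word w; [tagged_as] is the identity as
   long as the word is a path starting in the current vertex, and otherwise
   yields 0. *)
Definition act_arrow (p : framed_rep) (x : {q : vertex Q & M q})
    (a : arrow Q) : {q : vertex Q & M q} :=
  Tagged M (p.1 a (tagged_as (Tagged M (0 : M (src a))) x)).

Definition act_path (p : framed_rep) (q : vertex Q) (w : seq (arrow Q))
    (j : vertex Q) (x : M q) : M j :=
  tagged_as (Tagged M (0 : M j)) (foldl (act_arrow p) (Tagged M x) w).

(* M_w (f_q (v_{q,i})), read in M j. *)
Definition fvertex_vector (p : framed_rep) (j : vertex Q) (x : fvertex) : M j :=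
  act_path p (tagged x).2 j (p.2 (tag x) (tnth (v (tag x)) (tagged x).1)).

Definition has_basis (S : set fvertex) (p : framed_rep) : Prop :=
  forall j, finite_set (jvertices j S) /\
    basis_of {: M j}
      [seq fvertex_vector p j x | x <- fset_set (jvertices j S)].

(* U_S, as a set of points of [hilbert_scheme]. *)
Definition chart (S : set fvertex) : set (set framed_rep) :=
  [set c | hilbert_scheme c /\ exists2 p, c p & has_basis S p].

Definition Phi : set (set fvertex) :=
  [set S | subforest S /\ chart S !=set0].

End Moduli.

End Forests.

Arguments multipartition_of {Q n} leI leA d S j.
Arguments counted {Q n} leI leA S j m _.
Arguments Phi {Q n K} M {V} v _.

(* Main.v *)
Require Import Defs.
From mathcomp Require Import all_boot all_order all_algebra finmap.
From mathcomp Require Import boolp classical_sets functions cardinality reals.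
From mathcomp Require Import complex.
From mathcomp Require Import zify.

(* Let A(S) be the union of a finite subforest S and its corona. It consists of
   the roots and the children of elements of S, so if S has e_i i-vertices then
   A(S) has N_i(e) = n_i + \sum_{a : j -> i} e_j of them, and N_i(e) - e_i =
   n_i - <e,i>. Reading lambda^i backwards, it records the positions
     p_i(k) = k + lambda^i_{d_i - k},  0 <= k < d_i,
   of the i-vertices of S within the i-vertices of A(S): these positions are
   strictly increasing, and the condition defining S_{d,n} says that for e < d
   there is an i with e_i < d_i and p_i(e_i) < N_i(e).
   Whether x lies in A(S) depends only on the elements of S below x, since a
   parent precedes its children. Hence a smallest element of a symmetric
   difference contradicts equality of positions (injectivity); for e < d, the
   smallest element of S that is preceded by at least e_i others with the same
   terminal vertex i witnesses p_i(e_i) < N_i(e) (the values lie in S_{d,n}); and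
   S can be rebuilt from the p_i by repeatedly adding the smallest element of
   A(S) that sits at the next prescribed position for its terminal vertex, which
   exists as long as S is incomplete (surjectivity).
   Finally, Phi_{d,n} consists of all finite subforests with d_j j-vertices,
   because such an S is itself a basis of the representation in which an arrow
   sends x to its child in S, or to 0 if that child is not in S. *)

Set Implicit Arguments.
Unset Strict Implicit.
Unset Printing Implicit Defensive.

Import GRing.Theory.

Local Open Scope classical_set_scope.
Local Open Scope nat_scope.

(** * Greedy traversal of an ordered forest *)

Lemma leq_count_uniq (T : eqType) (p p' : pred T) (s s' : seq T) :
    uniq s -> {in s, forall y, p y -> (y \in s') && p' y} ->
  count p s <= count p' s'.
Proof.
move=> us sub; rewrite -!size_filter uniq_leq_size ?filter_uniq// => y.
by rewrite !mem_filter => /andP[py /sub/(_ py)/andP[-> ->]].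
Qed.

Section Rank.
Variables (T : eqType) (lt : rel T).
Hypotheses (lt_irr : irreflexive lt) (lt_trans : transitive lt).
Hypothesis lt_total : forall x y, x != y -> lt x y || lt y x.

Definition rank (P : pred T) (s : seq T) (x : T) : nat :=
  count (fun y => P y && lt y x) s.

Lemma rank_le P s x y : lt x y -> rank P s x <= rank P s y.
Proof.
move=> xy; apply: sub_count => z /andP[-> zx] /=; exact: lt_trans xy.
Qed.

Lemma rank_lt (P : pred T) s x y :
  x \in s -> P x -> lt x y -> rank P s x < rank P s y.
Proof.
move=> xs Px xy; elim: s xs => //= z s IHs.
rewrite inE => /orP[/eqP <-|/IHs ltr].
  by rewrite Px lt_irr xy /= add0n ltnS rank_le.
rewrite -addnS leq_add//; case: (P z) => //=.
by case zx: (lt z x) => //; rewrite (lt_trans zx xy).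
Qed.

Lemma rank_inj (P : pred T) s x y : x \in s -> y \in s -> P x -> P y ->
  rank P s x = rank P s y -> x = y.
Proof.
move=> xs ys Px Py eq_r; apply/eqP; apply: contraT => /lt_total/orP[] h.
  by have := rank_lt xs Px h; rewrite eq_r ltnn.
by have := rank_lt ys Py h; rewrite eq_r ltnn.
Qed.

Lemma rank_lt_count (P : pred T) s x :
  x \in s -> P x -> rank P s x < count P s.
Proof.
move=> xs Px; elim: s xs => //= z s IHs.
rewrite inE => /orP[/eqP <-|/IHs ltr].
  by rewrite Px lt_irr /= add0n ltnS; apply: sub_count => y /andP[].
by rewrite -addnS leq_add//; case: (P z) => //=; case: lt.
Qed.

(** Pigeonhole: the ranks are pairwise distinct and lie below [count P s], so they fill that
    interval. *)
Lemma exists_rank (P : pred T) s k : uniq s -> k < count P s ->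
  exists x, [/\ x \in s, P x & rank P s x = k].
Proof.
move=> us kP; pose t := filter P s.
have ut : uniq (map (rank P s) t).
  rewrite map_inj_in_uniq ?filter_uniq// => x y.
  by rewrite !mem_filter => /andP[Px xs] /andP[Py ys]; apply: rank_inj.
have sub : {subset map (rank P s) t <= iota 0 (count P s)}.
  move=> _ /mapP[x + ->]; rewrite mem_filter mem_iota => /andP[Px xs].
  exact: rank_lt_count.
have [|_ eqi] := uniq_min_size ut sub.
  by rewrite size_map size_filter size_iota.
have : k \in map (rank P s) t by rewrite eqi mem_iota.
case/mapP => x; rewrite mem_filter => /andP[Px xs] ->.
by exists x.
Qed.

Lemma exists_min (P : pred T) (s : seq T) x : x \in s -> P x ->
  exists y, [/\ y \in s, P y & forall z, z \in s -> P z -> ~~ lt z y].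
Proof.
move=> xs Px; have : 0 < count P (undup s).
  by rewrite -has_count; apply/hasP; exists x => //; rewrite mem_undup.
case/(exists_rank (undup_uniq s)) => y []; rewrite mem_undup => ys Py y0.
exists y; split=> // z zs Pz; apply/negP => zy.
by have := @rank_lt P (undup s) _ _ _ Pz zy; rewrite y0 mem_undup => /(_ zs).
Qed.

(** * Positions in a coloured order: [col] models the terminal vertex, [avail] a subforest with its
    corona *)

Section Greedy.
Variables (I : finType) (col : T -> I) (avail : seq T -> seq T).
Variables (d : I -> nat) (N : I -> (I -> nat) -> nat).

Definition coldim (E : seq T) (i : I) : nat := count (fun y => col y == i) E.
Definition colrank (E : seq T) (x : T) (i : I) : nat :=
  rank (fun y => col y == i) E x.

Definition hereditary (E : seq T) : Prop := {subset E <= avail E}.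

Hypothesis avail_uniq : forall E, uniq E -> uniq (avail E).
Hypothesis availS : forall E E' x,
  {in E, forall y, lt y x -> y \in E'} -> x \in avail E -> x \in avail E'.
Hypothesis coldim_avail : forall E i, coldim (avail E) i = N i (coldim E).
Hypothesis N_mono : forall i e e', (forall j, e j <= e' j) -> N i e <= N i e'.

(** Availability of some y < x involves only elements of [E] below y; these are below x and
    therefore in [E']. *)
Lemma colrank_avail_sub E E' x :
  uniq E -> {in E, forall y, lt y x -> y \in E'} ->
  forall i, colrank (avail E) x i <= colrank (avail E') x i.
Proof.
move=> uE sub i; apply: leq_count_uniq; first exact: avail_uniq.
move=> y yE /[dup] /andP[_ yx] ->; rewrite andbT.
by apply: availS yE => z zE zy; apply: sub => //; apply: lt_trans yx.
Qed.

Definition positions_of (E : seq T) (P : I -> nat -> nat) : Prop :=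
  {in E, forall x,
    colrank (avail E) x (col x) = P (col x) (colrank E x (col x))}.

Lemma exists_colrank E i k : uniq E -> k < coldim E i ->
  exists x, [/\ x \in E, col x = i & colrank E x i = k].
Proof. by move=> uE /(exists_rank uE)[x [xE /eqP cx rx]]; exists x. Qed.

Lemma positions_admissible E P (e : I -> nat) : uniq E -> hereditary E ->
    positions_of E P -> (forall i, e i <= coldim E i) ->
    (exists i, e i != coldim E i) ->
  exists i, e i < coldim E i /\ P i (e i) < N i e.
Proof.
move=> uE cE pE le_e [i0 ne_i0].
have lt_i0 : e i0 < coldim E i0 by rewrite ltn_neqAle ne_i0 le_e.
have [x0 [x0E cx0 rx0]] := exists_colrank uE lt_i0.
have [|x [xE Bx minx]] := @exists_min
    (fun y => e (col y) <= colrank E y (col y)) E x0 x0E.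
  by rewrite cx0 rx0.
(* A larger rank would give an element of colour [j] and rank [e j] below [x], against the
   minimality of [x]. *)
have le_r j : colrank E x j <= e j.
  rewrite leqNgt; apply/negP => lt_ej.
  have [z [zE /andP[/eqP cz zx] rz]] := exists_rank uE lt_ej.
  have := minx z zE; rewrite zx /= => /(_ _)/negP; apply; last by [].
  rewrite cz -rz; apply: sub_count => y /andP[/andP[-> _] ->] //.
have rx : colrank E x (col x) = e (col x) by apply/eqP; rewrite eqn_leq le_r.
exists (col x); split; first by rewrite -rx rank_lt_count.
rewrite -rx -pE//.
(* Cutting [E] off at [x] keeps [x] and all available elements below it available, and leaves at
   most [e j] elements of each colour j. *)
have sub : {in E, forall y, lt y x -> y \in [seq y <- E | lt y x]}.
  by move=> y yE yx; rewrite mem_filter yx.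
apply: (@leq_trans (coldim (avail [seq y <- E | lt y x]) (col x))); last first.
  rewrite coldim_avail N_mono// => j.
  rewrite (leq_trans _ (le_r j))// /coldim count_filter.
  by apply: sub_count => y /=.
apply: leq_ltn_trans (colrank_avail_sub uE sub _) _.
apply: rank_lt_count => //; apply: availS (cE _ xE); exact: sub.
Qed.

(** As [E] and [E'] agree below [x], the rank and position of [x] relative to both agree; the
    element z of [E'] with that colour and rank has the position of [x], which forces z = x. *)
Lemma positions_mem E E' P x :
    uniq E -> uniq E' -> hereditary E -> hereditary E' ->
    positions_of E P -> positions_of E' P -> coldim E =1 coldim E' ->
    x \in E -> {in E, forall y, lt y x -> y \in E'} ->
  {in E', forall y, lt y x -> y \in E} -> x \in E'.
Proof.
move=> uE uE' cE cE' pE pE' dE xE sub sub'.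
have eqr : colrank E x (col x) = colrank E' x (col x).
  apply/eqP; rewrite eqn_leq; apply/andP; split;
    apply: leq_count_uniq => // y yE /andP[-> yx]; rewrite yx !andbT.
    exact: sub.
  exact: sub'.
have eqrA : colrank (avail E) x (col x) = colrank (avail E') x (col x).
  by apply/eqP; rewrite eqn_leq !colrank_avail_sub.
have lt_r : colrank E x (col x) < coldim E' (col x).
  by rewrite -dE rank_lt_count.
have [z [zE' cz rz]] := exists_colrank uE' lt_r.
have xA : x \in avail E' by apply: availS (cE _ xE).
have := pE' z zE'; rewrite cz rz -pE// eqrA => rzA.
suff <- : z = x by [].
by apply: rank_inj rzA => //=; [exact: cE' | rewrite cz].
Qed.

Lemma positions_inj E E' P :
    uniq E -> uniq E' -> hereditary E -> hereditary E' ->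
    positions_of E P -> positions_of E' P -> coldim E =1 coldim E' ->
  E =i E'.
Proof.
move=> uE uE' cE cE' pE pE' dE w; apply: contraTeq isT => neq.
have [|x [_ Bx minx]] := @exists_min
    (fun y => (y \in E) != (y \in E')) (E ++ E') w _ neq.
  by rewrite mem_cat; case: (w \in E) (w \in E') neq => [] [].
have sub y : lt y x -> (y \in E) = (y \in E').
  move=> yx; apply/eqP; apply: contraTT yx => /[dup] neqy; apply: minx.
  by rewrite mem_cat; case: (y \in E) (y \in E') neqy => [] [].
case xE: (x \in E) Bx => Bx.
  move: Bx; rewrite (positions_mem uE uE' cE cE' pE pE' dE xE)// => y yE /sub.
    by rewrite yE => <-.
  by rewrite yE.
have xE' : x \in E' by case: (x \in E') Bx.
have dE' : coldim E' =1 coldim E by move=> j; rewrite dE.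
rewrite (positions_mem uE' uE cE' cE pE' pE dE' xE') in xE => // y yE /sub.
  by rewrite yE.
by rewrite yE => <-.
Qed.

(* [E] is an initial segment, in the order [lt], of the set whose elements are
   to have the positions [P]; the last clause says that in a colour which is not
   yet complete, the next prescribed position has not been passed. *)
Definition partial (P : I -> nat -> nat) (E : seq T) : Prop :=
  [/\ uniq E, hereditary E, forall i, coldim E i <= d i, positions_of E P &
    forall i, coldim E i < d i ->
      {in E, forall x, colrank (avail E) x i <= P i (coldim E i)}].

Section Existence.
Variable P : I -> nat -> nat.
Hypothesis P_mono : forall i k k', k < k' < d i -> P i k < P i k'.
Hypothesis P_admissible : forall e, (forall i, e i <= d i) ->
  (exists i, e i != d i) -> exists i, e i < d i /\ P i (e i) < N i e.

Lemma partial_extend E : partial P E -> (exists i, coldim E i != d i) ->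
  exists y, y \notin E /\ partial P (y :: E).
Proof.
move=> [uE cE le_d pE boundE] neq.
have uA := avail_uniq uE.
have [i0 [lt_i0]] := P_admissible le_d neq.
rewrite -coldim_avail => /(exists_colrank uA)[y0 [y0A cy0 ry0]].
pose B y := (coldim E (col y) < d (col y)) &&
  (colrank (avail E) y (col y) == P (col y) (coldim E (col y))).
have [|y [yA /andP[lt_y /eqP ry] miny]] := @exists_min B (avail E) y0 y0A.
  by rewrite /B cy0 lt_i0 ry0 /=.
(* Elements of [E] of this colour have ranks below the current count, so [P_mono] puts their
   positions strictly before that of [y]. *)
have yNE : y \notin E.
  apply/negP => yE; have := pE y yE; rewrite ry => eqP.
  have := @P_mono (col y) (colrank E y (col y)) (coldim E (col y)).
  by rewrite rank_lt_count//= lt_y eqP ltnn => /(_ isT).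
(* By the last clause of [partial], no element of [E] lies beyond the next prescribed position in
   the colour of [y], and [y] sits exactly there. *)
have Elt x : x \in E -> lt x y.
  move=> xE; have /lt_total/orP[//|yx] : x != y.
    by apply: contraNneq yNE => <-.
  have := boundE _ lt_y _ xE; rewrite -ry leqNgt => /negP[].
  by apply: rank_lt.
have notlt x : (x == y) || lt x y -> lt y x = false.
  case/orP=> [/eqP ->|xy]; first exact: lt_irr.
  by apply/negP => /(lt_trans xy); rewrite lt_irr.
have uyE : uniq (y :: E) by rewrite /= yNE.
(* Adding [y] makes only larger elements available, so positions up to [y] are unchanged. *)
have rA x i : (x == y) || lt x y ->
    colrank (avail (y :: E)) x i = colrank (avail E) x i.
  move=> xy; apply/eqP; rewrite eqn_leq !colrank_avail_sub// => z.
    by move=> zE _; rewrite inE zE orbT.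
  by rewrite inE => /orP[/eqP ->|//]; rewrite notlt.
have rE x i : (x == y) || lt x y -> colrank (y :: E) x i = colrank E x i.
  by move=> xy; rewrite /colrank /rank /= notlt// andbF.
have le_y x : x \in y :: E -> (x == y) || lt x y.
  by rewrite inE => /orP[->//|/Elt ->]; rewrite orbT.
have ryE i : colrank E y i = coldim E i.
  by apply: eq_in_count => z /Elt ->; rewrite andbT.
have dimE i : coldim (y :: E) i = (col y == i) + coldim E i by [].
exists y; split=> //; split=> //.
- have sub : {subset avail E <= avail (y :: E)}.
    by move=> x; apply: availS => z zE _; rewrite inE zE orbT.
  by move=> x; rewrite inE => /orP[/eqP ->|/cE]; apply: sub.
- by move=> i; rewrite dimE; case: (col y =P i) => [<-|_] /=; rewrite ?add0n.
- move=> x /[dup] xE /le_y xy; rewrite rA// rE//.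
  by move: xE; rewrite inE => /orP[/eqP ->|/pE //]; rewrite ryE.
- move=> i lt_i x /le_y xy; rewrite rA//.
  have le_xy : colrank (avail E) x i <= colrank (avail E) y i.
    by case/orP: xy => [/eqP ->//|]; apply: rank_le.
  apply: leq_trans le_xy _; move: lt_i; rewrite dimE.
  (* In the colour of [y] the next prescribed position moves strictly up; in another incomplete
     colour, having passed it would produce some z < y satisfying [B], against minimality. *)
  case: (col y =P i) => [<- lt_i|neqi lt_i].
    by rewrite ry ltnW// P_mono// lt_i andbT.
  rewrite leqNgt; apply/negP => lt_P.
  have [z [zA /andP[/eqP cz zy] rz]] := exists_rank uA lt_P.
  have := miny z zA; rewrite /B cz lt_i zy -[P _ _]rz => /(_ _)/negP; apply => //.
  apply/eqP/eq_in_count => x' _ /=.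
  by case x'z: (lt x' z); rewrite ?andbF// (lt_trans x'z zy) !andbT.
Qed.

Lemma exists_partial k : k <= \sum_i d i ->
  exists E, partial P E /\ \sum_i coldim E i = k.
Proof.
elim: k => [_|k IHk lt_k].
  exists [::]; split; last by rewrite big1.
  by split=> //; move=> i x.
have [E [pE sE]] := IHk (ltnW lt_k).
have le_d : forall i, coldim E i <= d i by case: pE.
have [|y [_ pyE]] := partial_extend pE.
  apply/existsP; apply: contraTT lt_k; rewrite negb_exists => /forallP eqd.
  by rewrite -leqNgt -sE leq_sum// => i _; rewrite (eqP (negPn (eqd i))).
exists (y :: E); split=> //; rewrite -sE big_split/= (bigD1 (col y))//= eqxx.
by rewrite big1 // => i; rewrite eq_sym => /negPf ->.
Qed.

Lemma exists_positions :
  exists E, [/\ uniq E, hereditary E, coldim E =1 d & positions_of E P].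
Proof.
have [E [[uE cE le_d pE _] sE]] := exists_partial (leqnn _).
exists E; split=> // i; apply/eqP; rewrite eqn_leq le_d/= leqNgt.
apply/negP => lt_i; have : \sum_i coldim E i < \sum_i d i.
  by rewrite (bigD1 i)//= [ltnRHS](bigD1 i)//= -addSn leq_add// leq_sum.
by rewrite sE ltnn.
Qed.

End Existence.

End Greedy.
End Rank.

(** * The order and the corona of the forest of a quiver *)

(** Transitivity and totality are relative to [E] because [leA] is assumed to be an order only among
    parallel arrows. *)
Definition strict_total_on (T : eqType) (E : T -> T -> Prop) (r : rel T) : Prop :=
  [/\ irreflexive r,
      forall y x z, E x y -> E y z -> r x y -> r y z -> r x z &
      forall x y, E x y -> x != y -> r x y || r y x].

Notation strict_total := (strict_total_on (fun _ _ => True)).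

(** The tie-breaker [r] has to be an order only among elements with equal keys, so nested uses
    collect the equalities of sources and of targets. *)
Lemma lex_strict_total (T A : eqType) (E : T -> T -> Prop) (f : T -> A)
    (v : rel A) (r : rel T) :
  strict_total v -> strict_total_on (fun x y => E x y /\ f x = f y) r ->
  strict_total_on E (fun x y => v (f x) (f y) || (f x == f y) && r x y).
Proof.
move=> [vi vt vc] [ri rt rc]; split=> [x|y x z Exy Eyz|x y Exy neq].
- by rewrite vi ri andbF.
- move=> /orP[vxy|/andP[/eqP fxy rxy]] /orP[vyz|/andP[/eqP fyz ryz]].
  + by rewrite (vt _ _ _ _ _ vxy vyz).
  + by rewrite -fyz vxy.
  + by rewrite fxy vyz.
  + by rewrite fxy fyz eqxx (rt y)// orbT.
- have [fxy|] := eqVneq (f x) (f y).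
    by case/orP: (rc _ _ (conj Exy fxy) neq) => ->; rewrite orbT ?orbT.
  by move=> /(vc _ _ I)/orP[] ->; rewrite ?orbT.
Qed.

Section ConcreteOrder.
Variables (Q : quiver) (n : dimvec Q).
Variables (leI : rel (vertex Q)) (leA : rel (arrow Q)).
Hypothesis leI_total : total_order_in predT leI.
Hypothesis leA_total : forall i j : vertex Q,
  total_order_in [pred a | (src a == i) && (tgt a == j)] leA.

Lemma vertex_lt_strict_total : strict_total (vertex_lt leI).
Proof.
case: leI_total => _ asym trans tot; split=> [x|y x z _ _|x y _ neq].
- by rewrite /vertex_lt eqxx.
- move=> /andP[nxy lxy] /andP[nyz lyz]; rewrite /vertex_lt (trans y)// andbT.
  apply: contra nxy => /eqP xz; apply/eqP/asym => //.
  by rewrite lxy xz lyz.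
- by rewrite /vertex_lt [y == x]eq_sym neq /=; apply: tot.
Qed.

Lemma arrow_lt_strict_total : strict_total (arrow_lt leI leA).
Proof.
apply: lex_strict_total vertex_lt_strict_total _.
apply: lex_strict_total vertex_lt_strict_total _.
split=> [x|y x z [[_ sxy] txy] [[_ syz] tyz]|x y [[_ sxy] txy] neq].
- by rewrite eqxx.
- have [_ asym trans _] := leA_total (src y) (tgt y).
  move=> /andP[nxy lxy] /andP[nyz lyz].
  have xD : x \in [pred a | (src a == src y) && (tgt a == tgt y)].
    by rewrite inE sxy txy !eqxx.
  have yD : y \in [pred a | (src a == src y) && (tgt a == tgt y)].
    by rewrite inE !eqxx.
  have zD : z \in [pred a | (src a == src y) && (tgt a == tgt y)].
    by rewrite inE syz tyz !eqxx.
  rewrite (trans y x z)// andbT.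
  apply: contra nxy => /eqP xz; apply/eqP/asym => //.
  by rewrite lxy xz lyz.
- have [_ _ _ tot] := leA_total (src y) (tgt y).
  rewrite [y == x]eq_sym neq /=; apply: tot; rewrite inE ?eqxx//.
  by rewrite sxy txy !eqxx.
Qed.

Lemma word_lt_strict_total : strict_total (word_lt leI leA).
Proof.
have [ai at_ ac] := arrow_lt_strict_total; split.
- by elim=> //= a w ->; rewrite ai andbF.
- elim=> [|b w IHw] [|a u] [|c v] //= _ _.
  move=> /orP[ab|/andP[/eqP ->] uw] /orP[bc|/andP[/eqP <- wv]].
  + by rewrite (at_ b).
  + by rewrite ab.
  + by rewrite bc.
  + by rewrite eqxx (IHw u v)// orbT.
- elim=> [|a u IHu] [|b w] //= _.
  rewrite eqseq_cons negb_and; have [->|nab _] := eqVneq a b.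
    by move=> /= /(IHu _ I)/orP[] ->; rewrite !orbT.
  by have /orP[] := ac _ _ I nab => ->; rewrite ?orbT.
Qed.

Notation T := {q : vertex Q & ('I_(n q) * seq (arrow Q))%type}.

Lemma fvertex_lt_strict_total : strict_total (@fvertex_lt Q n leI leA).
Proof.
have [wi wt wc] := word_lt_strict_total.
have : strict_total (fun x y : T => vertex_lt leI (tag x) (tag y) ||
    (tag x == tag y) && (((tagged x).1 < (tagged y).1) ||
      ((tagged x).1 == (tagged y).1 :> nat) &&
      word_lt leI leA (tagged x).2 (tagged y).2)).
  apply: lex_strict_total vertex_lt_strict_total _.
  apply: (@lex_strict_total _ _ _ (fun x : T => nat_of_ord (tagged x).1) ltn).
    split=> [x|y x z _ _|x y _]; [exact: ltnn|exact: ltn_trans|].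
    by rewrite neq_ltn.
  split=> [x|y x z _ _|x y [[_ sxy] ixy] neq]; [exact: wi|exact: wt|].
  apply: wc => //; apply: contra neq => /eqP wxy.
  case: x y sxy ixy wxy => [q [i w]] [q' [i' w']] /= qq'.
  by case: _ / qq' i' => i' /val_inj -> ->.
case=> i t c; split=> [[q [k w]]|[q [k w]] [q' [k' w']] [q'' [k'' w'']]|].
- exact: (i (Tagged _ (k, w))).
- exact: (t (Tagged _ (k, w)) (Tagged _ (k', w')) (Tagged _ (k'', w''))).
- by move=> [q [k w]] [q' [k' w']]; apply: c.
Qed.

End ConcreteOrder.

(** * Vertices of a subforest together with its corona *)

Section Available.
Variables (Q : quiver) (n : dimvec Q).
Notation T := {q : vertex Q & ('I_(n q) * seq (arrow Q))%type}.

Definition fend (x : T) : vertex Q := path_end (tag x) (tagged x).2.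

Definition child (x : T) (a : arrow Q) : T :=
  fvert (tagged x).1 (rcons (tagged x).2 a).

Definition roots : seq T :=
  [seq fvert i [::] | q <- enum (vertex Q), i <- enum 'I_(n q)].

Definition children (x : T) : seq T :=
  [seq child x a | a <- enum [pred a | src a == fend x]].

(* The vertices of [E] and of its corona, when [E] is a subforest. *)
Definition avail (E : seq T) : seq T := roots ++ flatten [seq children x | x <- E].

Lemma child_inj x y a b : child x a = child y b -> x = y /\ a = b.
Proof.
case: x y => [q [i w]] [q' [i' w']] /= e; have qq' := congr1 tag e.
move: qq' e => /= qq'; case: _ / qq' i' => i' /eqP.
rewrite eq_Tagged /= xpair_eqE => /andP[/eqP -> /eqP/rcons_inj[-> ->]].
by [].
Qed.

Lemma mem_roots (x : T) : (x \in roots) = ((tagged x).2 == [::]).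
Proof.
case: x => q [i w] /=; apply/allpairsPdep/eqP => [[q' [i' [_ _ /= e]]]|->].
  have := congr1 (fun x : T => (tagged x).2) e; exact.
by exists q, i; rewrite !mem_enum.
Qed.

Lemma mem_childrenP x y :
  reflect (exists2 a, src a = fend x & y = child x a) (y \in children x).
Proof.
apply: (iffP mapP) => [[a + ->]|[a sa ->]].
  by rewrite mem_enum inE => /eqP; exists a.
by exists a; rewrite // mem_enum inE sa.
Qed.

Lemma mem_availP E y : reflect ((tagged y).2 = [::] \/
  exists x a, [/\ x \in E, src a = fend x & y = child x a]) (y \in avail E).
Proof.
rewrite mem_cat mem_roots; apply: (iffP orP).
  move=> [/eqP|/flatten_mapP[x xE /mem_childrenP[a sa ya]]]; [by left|right].
  by exists x, a.
move=> [->|[x [a [xE sa ya]]]]; [by left|right].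
by apply/flatten_mapP; exists x => //; apply/mem_childrenP; exists a.
Qed.

Lemma avail_uniq E : uniq E -> uniq (avail E).
Proof.
move=> uE; rewrite cat_uniq; apply/and3P; split.
- apply: allpairs_uniq_dep => [|q _|]; rewrite ?enum_uniq//.
  move=> [q i] [q' i'] _ _ /= e.
  by have := congr1 (fun x : T => Tagged (fun q => 'I_(n q)) (tagged x).1) e.
- apply/hasPn => y /flatten_mapP[x _ /mem_childrenP[a _ ->]].
  by rewrite mem_roots /=; case: (tagged x).2.
- rewrite (_ : flatten _ =
    [seq child x a | x <- E, a <- enum [pred a | src a == fend x]]) //.
  apply: allpairs_uniq_dep => // [x _|]; first exact: enum_uniq.
  by move=> [x a] [y b] _ _ /= /child_inj[-> ->].
Qed.

Lemma fend_child x a : fend (child x a) = tgt a.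
Proof. by rewrite /fend /path_end /= map_rcons last_rcons. Qed.

(** Roots contribute [n j]; the rest counts pairs of some x in [E] and an arrow from [fend x] to
    [j], summed by arrows instead of by x. *)
Lemma coldim_avail E j : coldim fend (avail E) j =
  n j + \sum_(a : arrow Q | tgt a == j) coldim fend E (src a).
Proof.
rewrite /coldim count_cat; congr (_ + _).
  rewrite count_flatten -map_comp sumnE big_map big_enum /=.
  rewrite (bigD1 j)//= big1 => [|q neq].
    rewrite count_map (eq_count (a2 := predT)) ?count_predT ?size_enum_ord ?addn0//.
    by move=> i; rewrite /= /fend /path_end /= eqxx.
  rewrite count_map (eq_count (a2 := pred0)) ?count_pred0//.
  by move=> i; rewrite /= /fend /path_end /= (negPf neq).
rewrite count_flatten -map_comp sumnE big_map.
under [RHS]eq_bigr do rewrite -sum1_count big_mkcond.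
rewrite exchange_big; apply: eq_bigr => x _ /=.
rewrite count_map -big_mkcondr -sum1_count big_enum_cond /=.
by apply: eq_bigl => a; rewrite fend_child inE andbC [fend x == _]eq_sym.
Qed.

Lemma avail_local (lt : rel T) E E' x :
    (forall x a, lt x (child x a)) ->
  {in E, forall y, lt y x -> y \in E'} -> x \in avail E -> x \in avail E'.
Proof.
move=> ltc sub /mem_availP[x0|[y [a [yE sa xya]]]]; apply/mem_availP; [by left|right].
by exists y, a; split=> //; apply: sub => //; rewrite xya.
Qed.

Lemma forest_child x a : forest (child x a) <-> forest x /\ src a = fend x.
Proof.
case: x => q [i w]; rewrite /forest /fend /path_end /=.
suff -> : path_from q (rcons w a) = path_from q w && (src a == last q (map tgt w)).
  by split=> [/andP[-> /eqP]|[-> ->]]; rewrite ?eqxx.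
by elim: w q {i} => [|b w IHw] q //=; rewrite ?andbT// IHw andbA.
Qed.

Lemma fvertex_ind (P : T -> Prop) :
  (forall x, (tagged x).2 = [::] -> P x) -> (forall x a, P x -> P (child x a)) ->
  forall x, P x.
Proof.
move=> P0 Pc [q [i w]]; elim/last_ind: w => [|w a IHw]; first exact: P0.
exact: (Pc _ a IHw).
Qed.

Lemma child_neq_root x a : (tagged (child x a)).2 <> [::].
Proof. by rewrite /=; case: (tagged x).2. Qed.

Lemma mem_avail_child E x a :
  (child x a \in avail E) = (x \in E) && (src a == fend x).
Proof.
apply/mem_availP/andP => [[/child_neq_root//|[y [b [yE sb]]]]|[xE /eqP sa]].
  by move=> /child_inj[-> ->]; rewrite yE sb.
by right; exists x, a.
Qed.

Lemma mem_avail_root E x : (tagged x).2 = [::] -> x \in avail E.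
Proof. by move=> x0; apply/mem_availP; left. Qed.

(** Passing repeatedly to the parent reaches every initial subword, and availability of a child
    includes composability of its last arrow. *)
Lemma hereditary_subforest E : hereditary avail E <-> subforest [set` E].
Proof.
split=> [hE|[SF Spre] x].
  split=> [|q i u w].
    elim/fvertex_ind => [x x0 _|x a IHx /hE]; first by rewrite /forest /= x0.
    rewrite mem_avail_child => /andP[xE /eqP sa].
    by apply/forest_child; split=> //; apply: IHx.
  elim/last_ind: w => [|w a IHw]; first by rewrite cats0.
  rewrite -rcons_cat => /hE; rewrite -[fvert _ _]/(child (fvert i (u ++ w)) a).
  by rewrite mem_avail_child => /andP[/IHw].
elim/fvertex_ind: x => [x x0 _|x a _ cE]; first exact: mem_avail_root.
have [_ sa] := (forest_child x a).1 (SF _ cE).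
rewrite mem_avail_child sa eqxx andbT.
have := Spre _ (tagged x).1 (tagged x).2 [:: a]; rewrite cats1.
by case: x cE {sa} => q [i w] /= cE /(_ cE).
Qed.

Lemma coronaE E : hereditary avail E ->
  corona [set` E] = [set` [seq x <- avail E | x \notin E]].
Proof.
move=> hE; have [SF Spre] := (hereditary_subforest E).1 hE.
apply/seteqP; split=> x /=; rewrite mem_filter.
  move=> [Fx [q [i [[u [a [xua nx Su]]]|[xi nS]]]]].
    have xc : x = child (fvert i u) a by [].
    rewrite xc in nx Fx *; have [_ sa] := (forest_child _ _).1 Fx.
    by rewrite mem_avail_child sa eqxx andbT; apply/andP; split => //; apply/negP.
  rewrite xi mem_avail_root// andbT; apply/negP; exact: nS.
move=> /andP[/negP nx]; elim/fvertex_ind: x nx => [x x0|x a _] nx.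
  case: x x0 nx => [q [i w]] /= -> nx _; split=> //.
  (* The root is an initial subword of every vertex of its tree, so if it is missing then [E] misses
     the whole tree. *)
  exists q, i; right; split=> // u uE; apply: nx; exact: (Spre q i [::] u).
rewrite mem_avail_child => /andP[xE /eqP sa]; split.
  by apply/forest_child; split=> //; apply: SF.
case: x nx xE sa => [q [i w]] nx xE sa.
by exists q, i; left; exists w, a.
Qed.

End Available.

Lemma fvertex_lt_child (Q : quiver) (n : dimvec Q) (leI : rel (vertex Q))
    (leA : rel (arrow Q)) (x : {q : vertex Q & ('I_(n q) * seq (arrow Q))%type}) a :
  fvertex_lt leI leA x (child x a).
Proof.
case: x => q [i w]; rewrite /fvertex_lt /= !eqxx ltnn /=.
rewrite (_ : word_lt _ _ _ _) ?orbT//.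
by elim: w => //= b w ->; rewrite eqxx orbT.
Qed.

(** * Multipartitions *)

Lemma perm_fset_set_seq (T : choiceType) (s : seq T) :
  uniq s -> perm_eq (fset_set [set` s]) s.
Proof.
move=> us; apply: uniq_perm => // x.
by rewrite in_fset_set; [apply/idP/idP; rewrite inE | exact: finite_seq].
Qed.

Lemma card_fset_set_seq (T : choiceType) (s : seq T) :
  uniq s -> #|` fset_set [set` s]|%fset = size s.
Proof. by move=> us; apply/perm_size/perm_fset_set_seq. Qed.

Lemma card_le_seq (T : choiceType) (s : seq T) m :
  uniq s -> (`I_m #<= [set` s])%card = (m <= size s).
Proof.
move=> us; have /card_le_eqr -> : ([set` s] #= `I_(size s))%card.
  rewrite -card_fset_set_seq// -[X in (X #= _)%card]fset_setK//.
  exact/card_eq_fsetP.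
exact: card_le_II.
Qed.

(** Elements satisfying [P] lie below [x], lie above it or equal it, and [x] occurs once. This
    trades the counts from above in [counted] for ranks from below. *)
Lemma rank_flip (T : eqType) (lt : rel T) (P : pred T) (s : seq T) (x : T) :
    strict_total lt -> uniq s -> x \in s -> P x ->
  rank lt P s x + (rank (fun y z => lt z y) P s x).+1 = count P s.
Proof.
move=> [irr trans tot] us xs Px.
have -> : count P s = rank lt P s x + rank (fun y z => lt z y) P s x + count_mem x s.
  elim: s {us xs} => //= y s ->.
  have [->|neq] := eqVneq y x; first by rewrite Px irr /=; lia.
  have := tot _ _ I neq; case yx: (lt y x); case xy: (lt x y) => //= _.
    by have := trans _ _ _ I I yx xy; rewrite irr.
  - by case: (P y) => /=; lia.
  - by case: (P y) => /=; lia.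
by rewrite count_uniq_mem// xs; lia.
Qed.

Section Multi.
Variables (Q : quiver) (d n : dimvec Q).
Variables (leI : rel (vertex Q)) (leA : rel (arrow Q)).
Hypothesis leI_total : total_order_in predT leI.
Hypothesis leA_total : forall i j : vertex Q,
  total_order_in [pred a | (src a == i) && (tgt a == j)] leA.
Notation T := {q : vertex Q & ('I_(n q) * seq (arrow Q))%type}.
Notation lt := (@fvertex_lt Q n leI leA).
Notation above := (rank (fun y z => lt z y)).

Lemma jvertices_seq (E : seq T) j :
  jvertices j [set` E] = [set` [seq x <- E | fend x == j]].
Proof. by apply/seteqP; split=> x /=; rewrite mem_filter andbC => /andP. Qed.

Lemma countedE (E : seq T) j m : uniq E -> hereditary (@avail Q n) E ->
  counted leI leA [set` E] j m = [set` [seq x <- avail E |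
    [&& x \notin E, fend x == j & m <= above (fun y => fend y == j) E x]]].
Proof.
move=> uE hE; rewrite /counted /jvertices coronaE//.
have cE x : (`I_m #<= [set y | jvertices j [set` E] y /\ lt x y])%card =
    (m <= above (fun y => fend y == j) E x).
  rewrite [X in (_ #<= X)%card](_ : _ =
    [set` [seq y <- E | (fend y == j) && lt x y]]).
    by rewrite card_le_seq ?filter_uniq// size_filter.
  apply/seteqP; split=> y /=; rewrite mem_filter.
    by move=> [[-> cy] ->]; rewrite !andbT.
  by move=> /andP[/andP[cy yx] yE]; split.
apply/seteqP; split=> x /=; rewrite !mem_filter cE.
  by move=> [[/andP[-> ->] cx] ->]; rewrite !andbT; exact: cx.
by move=> /andP[/and3P[-> cx ->] ->].
Qed.

Lemma nth_multipartition_of (E : seq T) j m : uniq E -> hereditary (@avail Q n) E ->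
    m < d j ->
  nth 0 (multipartition_of leI leA d [set` E] j) m =
  count (fun x => [&& x \notin E, fend x == j &
    m < above (fun y => fend y == j) E x]) (avail E).
Proof.
move=> uE hE lt_m; rewrite (nth_mktuple _ _ (Ordinal lt_m)) countedE//=.
by rewrite card_fset_set_seq ?size_filter// filter_uniq// avail_uniq.
Qed.

(* The position, counted from 0, of the element of rank [k] of [S] that ends in
   [i], among all elements of [S] and of its corona that end in [i]. *)
Definition position (l : forall i, (d i).-tuple nat) (i : vertex Q) (k : nat) :=
  k + nth 0 (l i) (d i - k).-1.

(** A larger [k] reads an earlier, hence not smaller, part, and the summand [k] makes the increase
    strict. *)
Lemma position_mono (l : forall i, (d i).-tuple nat) i k k' :
  sorted geq (l i) -> k < k' < d i -> position l i k < position l i k'.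
Proof.
move=> sl /andP[kk' k'd]; rewrite /position -addSn leq_add//.
apply: (sorted_leq_nth _ _ 0 sl) => //.
- by move=> x y z /= yx zx; apply: leq_trans yx.
- exact: leqnn.
- by rewrite inE size_tuple; lia.
- by rewrite inE size_tuple; lia.
- by lia.
Qed.

Lemma position_inj (l l' : forall i, (d i).-tuple nat) :
  (forall i k, k < d i -> position l i k = position l' i k) -> l = l'.
Proof.
move=> eq_p; apply: functional_extensionality_dep => i.
apply/val_inj/(@eq_from_nth _ 0); rewrite ?size_tuple// => m lt_m.
have := eq_p i (d i - m.+1); rewrite /position.
have -> : (d i - (d i - m.+1)).-1 = m by lia.
by move=> h; apply/(@addnI (d i - m.+1))/h; lia.
Qed.

Lemma part_lt_position (l : forall i, (d i).-tuple nat) (e : dimvec Q) i :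
  e i <= d i ->
  part_lt (l i) (d i - e i) ((n i)%:Z - euler e (unit_dimvec i))%R =
  (e i < d i) && (position l i (e i) < n i + \sum_(a | tgt a == i) e (src a)).
Proof.
move=> le_e; rewrite /part_lt subn_gt0; congr andb.
have -> : euler e (unit_dimvec i) =
    ((e i)%:Z - (\sum_(a | tgt a == i) e (src a))%:Z)%R.
  rewrite /euler (bigD1 i)//= ffunE eqxx mulr1 big1 ?addr0; last first.
    by move=> j /negPf neq; rewrite ffunE neq mulr0.
  congr (_ - _)%R; rewrite -natz natr_sum [RHS]big_mkcond /=.
  apply: eq_bigr => a _; rewrite ffunE natz.
  by case: eqP => _; rewrite ?mulr1 ?mulr0.
rewrite /position; lia.
Qed.

(** Let s have rank k in its colour j. The available elements of colour j below s are k elements of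
    [E] and the corona elements below s. The latter are those with at least d_j - k elements of [E]
    of colour j above them, since s has exactly d_j - k - 1 above it. *)
Lemma positions_multipartition (E : seq T) : uniq E -> hereditary (@avail Q n) E ->
    coldim (@fend Q n) E =1 d ->
  positions_of lt (@fend Q n) (@avail Q n) E
    (position (multipartition_of leI leA d [set` E])).
Proof.
move=> uE hE dE s sE.
have st := fvertex_lt_strict_total n leI_total leA_total.
have [irr trans tot] := st.
pose j := fend s; pose inj (y : T) := fend y == j.
have eq_d : colrank lt (@fend Q n) E s j + (above inj E s).+1 = d j.
  by rewrite -dE rank_flip//= eqxx.
have lt_d : (d j - colrank lt (@fend Q n) E s j).-1 < d j by lia.
rewrite /position nth_multipartition_of//.
have -> : colrank lt (@fend Q n) (avail E) s j =
    count (fun x => (inj x && lt x s) && (x \in E)) (avail E) +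
    count (fun x => (inj x && lt x s) && (x \notin E)) (avail E).
  rewrite /colrank /rank; elim: (avail E) => //= x t ->.
  by case: (_ && lt x s) => //=; case: (x \in E) => /=; lia.
congr (_ + _).
  apply/eqP; rewrite eqn_leq; apply/andP; split; apply: leq_count_uniq => //.
  - exact: avail_uniq.
  - by move=> x _ /andP[/andP[cx xs] ->] /=; apply/andP.
  - by move=> x xE /andP[cx xs]; rewrite xE hE//= andbT; apply/andP.
apply: eq_in_count => x xA; rewrite andbC; case xE: (x \in E) => //=.
rewrite -/j -/(inj x); case cx: (inj x) => //=.
have -> : (d j - colrank lt (@fend Q n) E s j).-1 = above inj E s by lia.
have flip_trans : transitive (fun y z => lt z y).
  by move=> y x' z /= yx zy; apply: trans zy yx.
case xs: (lt x s).
  symmetry; apply: (@rank_lt _ (fun y z => lt z y) irr flip_trans inj E s x) => //.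
  by rewrite /inj eqxx.
have neq : x != s by apply: contraFneq xE => ->.
have := tot _ _ I neq; rewrite xs /= => sx.
by symmetry; rewrite ltnNge (@rank_le _ (fun y z => lt z y) flip_trans).
Qed.

(** [Phi'] enters only through its combinatorial description, which separates the bijection from the
    linear algebra. *)
Lemma multipartition_of_bij (Phi' : set (set T)) :
    (forall S, Phi' S <-> exists E : seq T, [/\ S = [set` E], uniq E,
       hereditary (@avail Q n) E & coldim (@fend Q n) E =1 d]) ->
  set_bij Phi' (multipartitions d n) (multipartition_of leI leA d).
Proof.
move=> PhiP.
have [irr trans_ tot_] := fvertex_lt_strict_total n leI_total leA_total.
have trans : transitive lt by move=> y x z; apply: trans_.
have tot x y : x != y -> lt x y || lt y x by apply: tot_.
have availS E E' x : {in E, forall y, lt y x -> y \in E'} ->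
    x \in avail E -> x \in avail E'.
  by apply: avail_local; apply: fvertex_lt_child.
pose N i (e : vertex Q -> nat) := n i + \sum_(a : arrow Q | tgt a == i) e (src a).
have N_mono i e e' : (forall j, e j <= e' j) -> N i e <= N i e'.
  by move=> le_e; rewrite leq_add2l leq_sum.
have dimA := @coldim_avail Q n.
split.
- move=> _ /PhiP[E [-> uE hE dE]]; split=> [i|e le_e neq].
    apply/(sortedP 0) => m; rewrite size_tuple => lt_m.
    rewrite !nth_multipartition_of// 1?ltnW//; apply: sub_count => x /=.
    by move=> /and3P[-> -> /ltnW].
  have [||i [lt_i lt_N]] := positions_admissible irr trans tot (@avail_uniq Q n)
    availS dimA N_mono uE hE (positions_multipartition uE hE dE) (e := e).
  + by move=> i; rewrite dE.
  + apply/existsP; apply: contra_notT neq; rewrite negb_exists => /forallP eqd.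
    by apply/ffunP => i; rewrite -dE; apply/eqP/negPn.
  by exists i; rewrite part_lt_position// -dE lt_i lt_N.
- move=> S S'; rewrite !inE => /PhiP[E [-> uE hE dE]] /PhiP[E' [-> uE' hE' dE']].
  move=> eq_l; have pE := positions_multipartition uE hE dE.
  rewrite eq_l in pE; have pE' := positions_multipartition uE' hE' dE'.
  have eqE := positions_inj irr trans tot (@avail_uniq Q n) availS uE uE' hE hE'
    pE pE' (fun j => etrans (dE j) (esym (dE' j))).
  by apply/seteqP; split=> x /=; rewrite eqE.
- move=> l [sl adm].
  have [||E [uE hE dE pE]] := exists_positions irr trans tot (@avail_uniq Q n)
    availS (N := N) dimA (d := fun i => d i) (P := position l).
  + by move=> i k k'; apply: position_mono.
  + move=> e le_e [i0 neq].
    have [||i] := adm [ffun i => e i]; first by move=> i; rewrite ffunE.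
      by move=> eq_e; rewrite -eq_e ffunE eqxx in neq.
    rewrite part_lt_position ?ffunE// => /andP[lt_i lt_N]; exists i; split=> //.
    by move: lt_N; under eq_bigr do rewrite ffunE.
  exists [set` E]; first by apply/PhiP; exists E.
  (* Both sides give the position of the element of [E] of colour [i] and rank [k]: one by the
     choice of [E], the other by [positions_multipartition]. *)
  apply: position_inj => i k lt_k.
  have lt_k' : k < coldim (@fend Q n) E i by rewrite dE.
  have [x [xE cx <-]] := exists_colrank irr trans tot uE lt_k'.
  by rewrite -cx -pE// -positions_multipartition.
Qed.

End Multi.

(** * Charts *)

Local Open Scope ring_scope.

Section Charts.
Variables (Q : quiver) (d n : dimvec Q) (K : fieldType).
Variables (M V : vertex Q -> vectType K) (v : forall q, (n q).-tuple (V q)).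
Hypothesis dimM : forall q, \dim {: M q} = d q.
Hypothesis v_basis : forall q, basis_of {: V q} (v q).
Notation T := {q : vertex Q & ('I_(n q) * seq (arrow Q))%type}.

(** [S] is a finite union of finite sets of j-vertices, and the length of a basis fixes their
    sizes. *)
Lemma Phi_forest S : Phi M v S -> exists E : seq T,
  [/\ S = [set` E], uniq E, hereditary (@avail Q n) E &
    coldim (@fend Q n) E =1 d].
Proof.
move=> [sub [c [_ [p _ basis]]]].
have fin : finite_set S.
  apply: (@sub_finite_set _ _ (\bigcup_j jvertices j S)).
    by move=> x Sx; exists (fend x) => //; split=> //; apply: eqxx.
  by apply: bigcup_finite => [|j _]; [exact: finite_finset | case: (basis j)].
have [E uE SE] : exists2 E : seq T, uniq E & S = [set` E].
  by exists (fset_set S); [exact: fset_uniq | rewrite fset_setK].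
subst S; exists E; split=> //.
  exact/hereditary_subforest.
move=> j; have [_] := basis j.
rewrite jvertices_seq => /(@size_basis _ _ _ _ (in_tuple _)).
by rewrite size_map dimM card_fset_set_seq ?filter_uniq// size_filter.
Qed.

(** * The representation with a finite subforest as its basis *)

Section TreeModule.
Variable E : seq T.
Hypothesis uE : uniq E.
Hypothesis hE : hereditary (@avail Q n) E.
Hypothesis dE : coldim (@fend Q n) E =1 d.

Definition jlist (j : vertex Q) : seq T := [seq x <- E | fend x == j].

(* Elements outside of [jlist j] have index [size (jlist j)], hence are sent
   to 0. *)
Definition tree_vector (j : vertex Q) (x : T) : M j :=
  (vbasis {: M j})`_(index x (jlist j)).

Lemma map_tree_vector j : map (tree_vector j) (jlist j) = vbasis {: M j}.
Proof.
have sz : size (jlist j) = size (vbasis {: M j}).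
  by rewrite size_filter size_tuple dimM -dE.
apply: (@eq_from_nth _ 0); rewrite size_map// => i lt_i.
have [x0] : exists x0, x0 \in jlist j.
  by case: (jlist j) lt_i => // y s _; exists y; rewrite mem_head.
move=> _; rewrite (nth_map x0)// /tree_vector index_uniq// filter_uniq//.
Qed.

(** Linear extension from the basis vectors attached to [jlist (src a)]; a child outside [E]
    contributes the zero vector. *)
Definition tree_arrow (a : arrow Q) : 'Hom(M (src a), M (tgt a)) :=
  linfun (sval (linear_of_free (vbasis {: M (src a)})
    [seq tree_vector (tgt a) (child x a) | x <- jlist (src a)])).

Definition tree_framing (q : vertex Q) : 'Hom(V q, M q) :=
  linfun (sval (linear_of_free (v q)
    [seq tree_vector q (fvert i [::]) | i <- enum 'I_(n q)])).

Definition tree_rep : framed_rep M V := (tree_arrow, tree_framing).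

Lemma tree_arrowE a x : x \in E -> src a = fend x ->
  tree_arrow a (tree_vector (src a) x) = tree_vector (tgt a) (child x a).
Proof.
move=> xE sa; have xj : x \in jlist (src a) by rewrite mem_filter sa eqxx.
rewrite lfunE /=; case: linear_of_free => f /= fP.
have sz : size [seq tree_vector (tgt a) (child y a) | y <- jlist (src a)] =
    size (vbasis {: M (src a)}) by rewrite -map_tree_vector !size_map.
have := congr1 (nth 0 ^~ (index x (jlist (src a))))
  (fP (basis_free (vbasisP _)) sz).
by rewrite /= -map_tree_vector -map_comp !(nth_map x) ?index_mem// nth_index.
Qed.

Lemma tree_framingE q i :
  tree_framing q (tnth (v q) i) = tree_vector q (fvert i [::]).
Proof.
rewrite lfunE /=; case: linear_of_free => f /= fP.
have sz : size [seq tree_vector q (fvert i [::]) | i <- enum 'I_(n q)] = size (v q).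
  by rewrite size_map size_enum_ord size_tuple.
have := congr1 (nth 0 ^~ i) (fP (basis_free (v_basis q)) sz).
rewrite /= (nth_map 0) ?size_tuple//.
by rewrite (nth_map i) ?size_enum_ord// nth_ord_enum (tnth_nth 0).
Qed.

(** All initial subwords stay in [E], so the path runs through basis vectors, and [tagged_as] never
    falls back on its default 0. *)
Lemma foldl_act_arrow x : x \in E ->
  foldl (act_arrow tree_rep)
    (Tagged M (tree_rep.2 (tag x) (tnth (v (tag x)) (tagged x).1))) (tagged x).2 =
  Tagged M (tree_vector (fend x) x).
Proof.
elim/fvertex_ind: x => [[q [i w]] /= -> _|x a IHx /hE].
  by rewrite tree_framingE.
rewrite mem_avail_child => /andP[xE /eqP sa] /=.
rewrite foldl_rcons IHx// /act_arrow fend_child.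
have -> : tagged_as (Tagged M (0 : M (src a))) (Tagged M (tree_vector (fend x) x)) =
    tree_vector (src a) x.
  by rewrite sa tagged_asE.
by rewrite tree_arrowE.
Qed.

Lemma fvertex_vectorE j x : x \in jlist j ->
  fvertex_vector v tree_rep j x = tree_vector j x.
Proof.
rewrite mem_filter => /andP[/eqP <- xE].
by rewrite /fvertex_vector /act_path foldl_act_arrow// tagged_asE.
Qed.

Lemma generated_tree_rep : generated tree_rep.
Proof.
move=> U Uf Ua q; apply/eqP; rewrite eqEsubv subvf -(span_basis (vbasisP {: M q})).
apply/span_subvP => u; rewrite -map_tree_vector => /mapP[x + ->] {u}.
rewrite mem_filter => /andP[/eqP <- xE].
elim/fvertex_ind: x xE => [[q' [i w]] /= -> _|x a IHx /hE].
  rewrite -tree_framingE; apply: subvP (Uf q') _ _.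
  exact: memv_img (memvf _).
rewrite mem_avail_child => /andP[xE /eqP sa].
rewrite fend_child -tree_arrowE//; apply: subvP (Ua a) _ _.
by apply: memv_img; rewrite sa; apply: IHx.
Qed.

Lemma orbit_refl (p : framed_rep M V) : orbit_of p p.
Proof.
exists (fun q => \1%VF); split=> [q|a|q].
- by apply/lker0P => x y; rewrite !id_lfunE.
- have id_inv : (\1^-1 = \1 :> 'End(M (src a)))%VF.
    rewrite -[LHS]comp_lfun1l; apply: lker0_compfV.
    by apply/lker0P => x y; rewrite !id_lfunE.
  by rewrite id_inv comp_lfun1l comp_lfun1r.
- by rewrite comp_lfun1l.
Qed.

Lemma forest_Phi : Phi M v [set` E].
Proof.
split; first exact/hereditary_subforest.
exists (orbit_of tree_rep); split.
  by exists tree_rep => //; apply: generated_tree_rep.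
exists tree_rep; first exact: orbit_refl.
move=> j; rewrite jvertices_seq; split; first exact: finite_seq.
rewrite (perm_basis _ (perm_map _ (perm_fset_set_seq (filter_uniq _ uE)))).
have /eq_in_map eqv := @fvertex_vectorE j.
by rewrite -/(jlist j) eqv map_tree_vector vbasisP.
Qed.

End TreeModule.
End Charts.

Theorem theorem8p2 (R : realType) (Q : quiver) (d n : dimvec Q)
  (leI : rel (vertex Q)) (leA : rel (arrow Q))
  (leI_total : total_order_in predT leI)
  (leA_total : forall i j : vertex Q,
     total_order_in [pred a | (src a == i) && (tgt a == j)] leA)
  (M V : vertex Q -> vectType R[i])
  (v : forall q, (n q).-tuple (V q))
  (dimM : forall q, \dim {: M q} = d q)
  (v_basis : forall q, basis_of {: V q} (v q)) :
  (forall S, Phi M v S -> forall (j : vertex Q) (m : nat),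
     (1 <= m <= d j)%N -> finite_set (counted leI leA S j m)) /\
  set_bij (Phi M v) (multipartitions d n) (multipartition_of leI leA d).
Proof.
split=> [S /(Phi_forest dimM)[E [-> uE hE _]] j m _|].
  (* Finiteness guarantees that [fset_set] in [multipartition_of] takes genuine cardinalities
     instead of its default value. *)
  by rewrite countedE//; apply: finite_seq.
apply: multipartition_of_bij => // S; split; first exact: Phi_forest.
by move=> [E [-> uE hE dE]]; apply: forest_Phi.
Qed.
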